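(* Let $\mathbb F$ be $\mathbb R$ or $\mathbb C$, and let $I,J,K,R$ be positive integers such that $3\leq I\leq J\leq R\leq K$ and $R\leq (I-1)(J-1)$. Then the CPD of an $I\times J\times K$ tensor of rank $R$ (over $\mathbb F$) is generically unique.
   Context: A tensor $\mathcal T\in\mathbb F^{I\times J\times K}$ is rank-1 if $\mathcal T=\mathbf a\circ\mathbf b\circ\mathbf c$ for nonzero vectors $\mathbf a\in\mathbb F^I$, $\mathbf b\in\mathbb F^J$, $\mathbf c\in\mathbb F^K$, where $\circ$ is the outer product, i.e. $t_{ijk}=a_ib_jc_k$. For matrices $\mathbf A=[\mathbf a_1\ \dots\ \mathbf a_R]\in\mathbb F^{I\times R}$, $\mathbf B=[\mathbf b_1\ \dots\ \mathbf b_R]\in\mathbb F^{J\times R}$, $\mathbf C=[\mathbf c_1\ \dots\ \mathbf c_R]\in\mathbb F^{K\times R}$ write $[\mathbf A,\mathbf B,\mathbf C]_R=\sum_{r=1}^R\mathbf a_r\circ\mathbf b_r\circ\mathbf c_r$. The rank of $\mathcal T$ is the minimal number of rank-1 tensors (over $\mathbb F$) whose sum is $\mathcal T$; a decomposition of $\mathcal T$ into this minimal number of rank-1 terms is called a canonical polyadic decomposition (CPD) of $\mathcal T$. The CPD of $\mathcal T$ is unique if it is only subject to permutation of the rank-1 terms and to rescaling of the vectors within a rank-1 term that leaves the term unchanged (i.e. the collection of rank-1 terms is uniquely determined up to order). Let $\mu_{\mathbb F}$ be the Lebesgue measure on $\mathbb F^{I\times R}\times\mathbb F^{J\times R}\times\mathbb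 F^{K\times R}$. The CPD of an $I\times J\times K$ tensor of rank $R$ is generically unique if $$\mu_{\mathbb F}\{(\mathbf A,\mathbf B,\mathbf C):\ \text{the CPD of the tensor } [\mathbf A,\mathbf B,\mathbf C]_R \text{ is not unique}\}=0.$$ *)

(* Defs.v *)
From HB Require Import structures.
From mathcomp Require Import all_boot all_order all_algebra.
From mathcomp Require Import complex.
From mathcomp Require Import all_classical all_reals all_analysis.

Set Implicit Arguments.
Unset Strict Implicit.
Unset Printing Implicit Defensive.

Import Order.TTheory GRing.Theory Num.Theory.

Local Open Scope classical_set_scope.
Local Open Scope ring_scope.

(* Tensors of size I x J x K, with entries indexed by ((i, j), k). *)
Notation tensor F I J K := {ffun 'I_I * 'I_J * 'I_K -> F}.

Section CPD.
Variables (F : fieldType) (I J K : nat).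
Implicit Types (T : tensor F I J K) (s : seq (tensor F I J K)).

Definition outer (a : 'cV[F]_I) (b : 'cV[F]_J) (c : 'cV[F]_K) : tensor F I J K :=
  [ffun ijk => a ijk.1.1 0 * b ijk.1.2 0 * c ijk.2 0].

Definition rank1 T : Prop :=
  exists (a : 'cV[F]_I) (b : 'cV[F]_J) (c : 'cV[F]_K),
    [/\ a != 0, b != 0, c != 0 & T = outer a b c].

Definition polyadic r (A : 'M[F]_(I, r)) (B : 'M[F]_(J, r)) (C : 'M[F]_(K, r)) :
    tensor F I J K :=
  \sum_(l < r) outer (col l A) (col l B) (col l C).

Definition rank1_decomposition T s : Prop :=
  (forall X, X \in s -> rank1 X) /\ \sum_(X <- s) X = T.

Definition has_rank T (r : nat) : Prop :=
  (exists2 s, rank1_decomposition T s & size s = r) /\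
  (forall s, rank1_decomposition T s -> (r <= size s)%N).

Definition is_CPD T s : Prop :=
  rank1_decomposition T s /\ has_rank T (size s).

(* A CPD is recorded by its list of rank-1 terms, not by factor matrices, so
   rescalings inside a term are already quotiented out. *)
Definition CPD_unique T : Prop :=
  exists2 s, is_CPD T s & forall s', is_CPD T s' -> perm_eq s' s.

End CPD.

Section transport_measurable.
Context d (T1 : measurableType d) (T2 : Type) (f : T2 -> T1).

Let trans := preimage_set_system [set: T2] f measurable.

Lemma transport_set0 : trans set0.
Proof. by exists set0 => //; rewrite setTI preimage_set0. Qed.

Lemma transport_setC A : trans A -> trans (~` A).
Proof.
by move=> [B mB <-]; exists (~` B); [exact: measurableC|rewrite !setTI].
Qed.

Lemma transport_bigcup (G : (set T2)^nat) :
  (forall i, trans (G i)) -> trans (\bigcup_i (G i)).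
Proof.
move=> /(_ _)/cid2-/all_sig2[H mH GE]; exists (\bigcup_i H i).
  exact: bigcupT_measurable.
rewrite setTI preimage_bigcup; apply: eq_bigcupr => i _.
by rewrite -GE setTI.
Qed.

End transport_measurable.

Lemma sigma_finite_measureP d (T : measurableType d) (R : realType)
    (mu : {measure set T -> \bar R}) : sigma_finite [set: T] mu ->
  exists nu : {sigma_finite_measure set T -> \bar R},
    mu = nu :> (set T -> \bar R).
Proof.
move=> sf.
pose nu : {sigma_finite_measure set T -> \bar R} :=
  HB.pack (Measure.sort mu)
    (isSFinite.Build _ _ _ (Measure.sort mu) (sfinite_measure_sigma_finite sf))
    (isSigmaFinite.Build _ _ _ (Measure.sort mu) sf).
by exists nu.
Qed.

Section transport_measure.
Context d1 d2 (T1 : measurableType d1) (T2 : measurableType d2) (R : realType).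
Variables (mu : {measure set T1 -> \bar R}) (muT : sigma_finite [set: T1] mu).
Variables (f : T1 -> T2) (g : T2 -> T1).
Hypotheses (mf : measurable_fun [set: T1] f) (mg : measurable_fun [set: T2] g).
Hypothesis fK : cancel f g.

Lemma pushforward_sigma_finite : sigma_finite [set: T2] (pushforward mu f).
Proof.
have [F FT Foo] := muT.
exists (fun n => g @^-1` F n).
  by rewrite -preimage_bigcup -FT preimage_setT.
move=> n; have [mF Fn] := Foo n; split.
  by rewrite -[X in measurable X]setTI; exact: mg.
rewrite /pushforward -comp_preimage (_ : g \o f = id) ?preimage_id//.
by apply/funext => x /=; rewrite fK.
Qed.

Lemma pushforward_sigma_finiteP :
  exists nu : {sigma_finite_measure set T2 -> \bar R},
    pushforward mu f = nu :> (set T2 -> \bar R).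
Proof.
exact: (@sigma_finite_measureP _ _ _ (pushforward mu f : measure T2 R)
  pushforward_sigma_finite).
Qed.

End transport_measure.

Lemma product_sigma_finite d1 d2 (T1 : measurableType d1)
    (T2 : measurableType d2) (R : realType)
    (m1 : {sigma_finite_measure set T1 -> \bar R})
    (m2 : {sigma_finite_measure set T2 -> \bar R}) :
  sigma_finite [set: T1 * T2] (m1 \x m2)%E.
Proof.
have /sigma_finiteP[F [TF ndF Foo]] := sigma_finiteT m1.
have /sigma_finiteP[G [TG ndG Goo]] := sigma_finiteT m2.
exists (fun n => F n `*` G n).
  rewrite -setXTT TF TG; apply/seteqP; split => [[x y]|[x y]].
    move=> [/= [n _ Fnx] [k _ Gky]]; exists (maxn n k) => //; split.
      by move: x Fnx; exact/subsetPset/ndF/leq_maxl.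
    by move: y Gky; exact/subsetPset/ndG/leq_maxr.
  by move=> [n _ []/= ? ?]; split; exists n.
move=> k; have [? ?] := Foo k; have [? ?] := Goo k.
split; first exact: measurableX.
by rewrite product_measure1E// lte_mul_pinfty// ge0_fin_numE.
Qed.

Section eq_sigma_finite_measure.
Context d (T : measurableType d) (R : realType) (m : set T -> \bar R).
Hypothesis mP : exists nu : {sigma_finite_measure set T -> \bar R},
  m = nu :> (set T -> \bar R).

Lemma eq_measure0 : m set0 = 0%E.
Proof. by have [nu ->] := mP; rewrite measure0. Qed.

Lemma eq_measure_ge0 A : (0 <= m A)%E.
Proof. by have [nu ->] := mP; exact: measure_ge0. Qed.

Lemma eq_measure_sigma_additive : semi_sigma_additive m.
Proof. by have [nu ->] := mP; exact: measure_semi_sigma_additive. Qed.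

Lemma eq_measure_sigma_finite : sigma_finite setT m.
Proof. by have [nu ->] := mP; exact: sigma_finiteT. Qed.

End eq_sigma_finite_measure.

Section tuple_measure.
Context d (T : measurableType d) (R : realType).
Variable mu : {sigma_finite_measure set T -> \bar R}.

Fixpoint tuple_measure (n : nat) : set (n.-tuple T) -> \bar R :=
  match n with
  | 0 => \d_ [tuple]
  | n'.+1 => pushforward (mu \x tuple_measure (n := n'))%E
               (fun p => cons_tuple p.1 p.2)
  end.
Arguments tuple_measure n _ : clear implicits.

Let cons_pair n (p : T * n.-tuple T) : n.+1.-tuple T := cons_tuple p.1 p.2.
Let uncons n (t : n.+1.-tuple T) := (thead t, [tuple of behead t]).

Let cons_pairK n : cancel (@cons_pair n) (@uncons n).
Proof. by move=> [x t]; rewrite /uncons theadE; congr pair; exact/val_inj. Qed.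

Let measurable_cons_pair n : measurable_fun setT (@cons_pair n).
Proof. exact: (measurable_cons measurable_fst measurable_snd). Qed.

Let measurable_uncons n : measurable_fun setT (@uncons n).
Proof.
apply/measurable_fun_pairP; split; first exact: measurable_tnth.
exact: measurable_behead.
Qed.

Lemma tuple_measureP n :
  exists nu : {sigma_finite_measure set (n.-tuple T) -> \bar R},
    tuple_measure n = nu :> (set (n.-tuple T) -> \bar R).
Proof.
elim: n => [|n [nu nuE]]; first by exists (\d_ [tuple]).
rewrite /= nuE.
exact: (pushforward_sigma_finiteP (product_sigma_finite mu nu)
  (@measurable_cons_pair n) (@measurable_uncons n) (@cons_pairK n)).
Qed.

HB.instance Definition _ n := isMeasure.Build _ _ _ (tuple_measure n)
  (eq_measure0 (tuple_measureP n)) (eq_measure_ge0 (tuple_measureP n))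
  (eq_measure_sigma_additive (tuple_measureP n)).
HB.instance Definition _ n := Measure_isSigmaFinite.Build _ _ _
  (tuple_measure n) (eq_measure_sigma_finite (tuple_measureP n)).

End tuple_measure.

Arguments tuple_measure {d T R} mu n _.

Lemma tuple_measure_box d (T : measurableType d) (R : realType)
    (mu : {sigma_finite_measure set T -> \bar R}) n (B : 'I_n -> set T) :
  (forall i, measurable (B i)) ->
  tuple_measure mu n [set t | forall i, B i (tnth t i)] = (\prod_(i < n) mu (B i))%E.
Proof.
elim: n B => [|n IH] B mB /=.
  by rewrite big_ord0 diracE mem_set//= => -[].
rewrite big_ord_recl -IH// -product_measure1E//.
- rewrite /pushforward; congr (_ _); apply/seteqP; split => [[x t] /= H|[x t] /= [H1 H2] i].
    split; first by have := H ord0; rewrite (tnth_nth x).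
    by move=> i; have := H (lift ord0 i); rewrite !(tnth_nth x).
  case: (unliftP ord0 i) => [j ->|->]; last by rewrite (tnth_nth x).
  by have := H2 j; rewrite !(tnth_nth x).
- rewrite (_ : [set _ | _] = \bigcap_(i in setT) (fun t : n.-tuple T => tnth t i) @^-1` B (lift ord0 i)); last first.
    by apply/seteqP; split => [t H i _|t H i]; exact: H.
  apply: fin_bigcap_measurable; first exact: finite_finset.
  by move=> i _; rewrite -[X in measurable X]setTI; exact: measurable_tnth.
Qed.

Definition mx_display : measure_display -> measure_display.
Proof. exact. Qed.

Definition mx_tuple (T : Type) m n (A : 'M[T]_(m, n)) : (m * n).-tuple T :=
  [tuple mxvec A 0 k | k < m * n].

Definition tuple_mx (T : Type) m n (t : (m * n).-tuple T) : 'M[T]_(m, n) :=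
  vec_mx (\row_k tnth t k).

Lemma tuple_mxK (T : Type) m n : cancel (@tuple_mx T m n) (@mx_tuple T m n).
Proof.
move=> t; apply: eq_from_tnth => k.
by rewrite tnth_mktuple /tuple_mx vec_mxK mxE.
Qed.

Lemma mx_tupleK (T : Type) m n : cancel (@mx_tuple T m n) (@tuple_mx T m n).
Proof.
move=> A; rewrite /tuple_mx -[RHS]mxvecK; congr vec_mx; apply/rowP => k.
by rewrite mxE tnth_mktuple.
Qed.

Section mx_measurable.
Context d (T : measurableType d) (m n : nat).

HB.instance Definition _ := @isMeasurable.Build (mx_display d) 'M[T]_(m, n)
  (preimage_set_system setT (@mx_tuple T m n) measurable)
  (transport_set0 (@mx_tuple T m n))
  (@transport_setC _ _ _ (@mx_tuple T m n))
  (@transport_bigcup _ _ _ (@mx_tuple T m n)).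

Lemma measurable_mx_tuple : measurable_fun setT (@mx_tuple T m n).
Proof. by move=> _ B mB; exists B. Qed.

Lemma measurable_tuple_mx : measurable_fun setT (@tuple_mx T m n).
Proof.
move=> _ _ [B mB <-]; rewrite !setTI -comp_preimage.
by rewrite (_ : _ \o _ = id) ?preimage_id//; apply/funext/tuple_mxK.
Qed.

End mx_measurable.

Section mx_measure.
Context d (T : measurableType d) (R : realType).
Variable mu : {sigma_finite_measure set T -> \bar R}.

(* The mn-fold product measure of mu on the entries of an m x n matrix. *)
Definition mx_measure (m n : nat) : set 'M[T]_(m, n) -> \bar R :=
  pushforward (tuple_measure mu (m * n)) (@tuple_mx T m n).
Arguments mx_measure m n _ : clear implicits.

Lemma mx_measureP m n :
  exists nu : {sigma_finite_measure set 'M[T]_(m, n) -> \bar R},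
    mx_measure m n = nu :> (set 'M[T]_(m, n) -> \bar R).
Proof.
exact: (pushforward_sigma_finiteP (sigma_finiteT (tuple_measure mu (m * n)))
  (@measurable_tuple_mx _ _ m n) (@measurable_mx_tuple _ _ m n)
  (@tuple_mxK _ m n)).
Qed.

HB.instance Definition _ m n := isMeasure.Build _ _ _ (mx_measure m n)
  (eq_measure0 (mx_measureP m n)) (eq_measure_ge0 (mx_measureP m n))
  (eq_measure_sigma_additive (mx_measureP m n)).
HB.instance Definition _ m n := Measure_isSigmaFinite.Build _ _ _
  (mx_measure m n) (eq_measure_sigma_finite (mx_measureP m n)).

End mx_measure.

Arguments mx_measure {d T R} mu m n _.

(* The library's lebesgue_measure lives on the alias measurableTypeR of the
   reals, whose sigma-algebra is the Borel one but whose display differs from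
   that of the measurableType structure of R itself. *)
Section real_lebesgue.
Variable R : realType.

Definition real_lebesgue : set R -> \bar R := @lebesgue_measure R.

HB.instance Definition _ := isMeasure.Build _ _ _ real_lebesgue
  (@measure0 _ _ _ (@lebesgue_measure R))
  (@measure_ge0 _ _ _ (@lebesgue_measure R))
  (@measure_semi_sigma_additive _ _ _ (@lebesgue_measure R)).
HB.instance Definition _ := Measure_isSigmaFinite.Build _ _ _ real_lebesgue
  (sigma_finiteT (@lebesgue_measure R)).

End real_lebesgue.

Definition complex_display : measure_display.
Proof. exact: default_measure_display. Qed.

Definition complex_pair (R : Type) (z : R[i]) : R * R :=
  (complex.Re z, complex.Im z).

Definition pair_complex (R : Type) (p : R * R) : R[i] := Complex p.1 p.2.

Lemma pair_complexK (R : Type) : cancel (@pair_complex R) (@complex_pair R).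
Proof. by case. Qed.

Section complex_lebesgue.
Variable R : realType.

HB.instance Definition _ := isPointed.Build R[i] 0.
HB.instance Definition _ := @isMeasurable.Build complex_display R[i]
  (preimage_set_system setT (@complex_pair R) measurable)
  (transport_set0 (@complex_pair R))
  (@transport_setC _ _ _ (@complex_pair R))
  (@transport_bigcup _ _ _ (@complex_pair R)).

Lemma measurable_complex_pair : measurable_fun setT (@complex_pair R).
Proof. by move=> _ B mB; exists B. Qed.

Lemma measurable_pair_complex : measurable_fun setT (@pair_complex R).
Proof.
move=> _ _ [B mB <-]; rewrite !setTI -comp_preimage.
by rewrite (_ : _ \o _ = id) ?preimage_id//; apply/funext/pair_complexK.
Qed.

Definition complex_lebesgue : set R[i] -> \bar R :=
  pushforward (@real_lebesgue R \x @real_lebesgue R)%E (@pair_complex R).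

Lemma complex_lebesgueP :
  exists nu : {sigma_finite_measure set R[i] -> \bar R},
    complex_lebesgue = nu :> (set R[i] -> \bar R).
Proof.
exact: (pushforward_sigma_finiteP
  (product_sigma_finite (@real_lebesgue R) (@real_lebesgue R))
  measurable_pair_complex measurable_complex_pair (@pair_complexK R)).
Qed.

HB.instance Definition _ := isMeasure.Build _ _ _ complex_lebesgue
  (eq_measure0 complex_lebesgueP) (eq_measure_ge0 complex_lebesgueP)
  (eq_measure_sigma_additive complex_lebesgueP).
HB.instance Definition _ := Measure_isSigmaFinite.Build _ _ _
  complex_lebesgue (eq_measure_sigma_finite complex_lebesgueP).

End complex_lebesgue.

Definition factor_measure d (T : measurableType d) (R : realType)
    (mu : {sigma_finite_measure set T -> \bar R}) (I J K r : nat) :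
    set ('M[T]_(I, r) * 'M[T]_(J, r) * 'M[T]_(K, r)) -> \bar R :=
  ((mx_measure mu I r \x mx_measure mu J r) \x mx_measure mu K r)%E.

Arguments factor_measure {d T R} mu I J K r _.

Definition nonunique_CPD (F : fieldType) (I J K r : nat) :
    set ('M[F]_(I, r) * 'M[F]_(J, r) * 'M[F]_(K, r)) :=
  [set ABC | ~ CPD_unique (polyadic ABC.1.1 ABC.1.2 ABC.2)].

Arguments nonunique_CPD F I J K r _ : clear implicits.

(* N is mu.-negligible when it is included in a mu-null measurable set, i.e.
   when N has measure zero for the completion of mu. *)
Definition generically_unique_CPD_real (R : realType) (I J K r : nat) : Prop :=
  (factor_measure (@real_lebesgue R) I J K r).-negligible
    (nonunique_CPD R I J K r).

Definition generically_unique_CPD_complex (R : realType) (I J K r : nat) : Prop :=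
  (factor_measure (@complex_lebesgue R) I J K r).-negligible
    (nonunique_CPD R[i] I J K r).

(* Main.v *)
Require Import Defs.
From mathcomp Require Import all_boot all_order all_algebra.
From mathcomp Require Import complex.
From mathcomp Require Import all_classical all_reals all_analysis.
From mathcomp Require Import ring zify.

(** Why the theorem is true.

    Write m_l for the rank-1 matrix a_l b_l^T.  If the columns of C are linearly
    independent (which is generic, as r <= K), then the slices of the tensor span
    the same space of matrices as m_1, ..., m_r.  Suppose that the only matrices
    of rank at most 1 in this space are the multiples of the m_l
    ([segre_general]).  Then any other decomposition into r terms consists of
    matrices of rank 1 in that space, so it permutes and rescales the m_l, and
    the vectors c_l follow by linear independence
    ([CPD_unique_of_segre_general]).

    It remains to see that [segre_general] holds for generic A and B, and this is
    a count of parameters.  Assume that sum_l d_l a_l b_l^T = x y^T with at least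
    two nonzero d_l.  When at most J of the d_l are nonzero, the corresponding b_l
    are independent, so the corresponding a_l are proportional, which is not
    generic.  Otherwise choose J indices u_1, ..., u_J with d_(u_k) != 0 and one
    more index l0, normalised by d_l0 = 1.  Inverting the square matrix with
    columns b_(u_k) expresses the J columns a_(u_k) polynomially in B, the other
    columns of A, the other coefficients d_l, the vectors x and y (normalised
    by x_i0 = 1), and J reciprocals.  So (A, B) lies in the image of
    a polynomial map from a space of dimension
      r J + (r - J) I + (r - J - 1) + J + (I - 1) + J,
    which is less than the dimension r I + r J of the space of all (A, B) exactly
    when r <= (I - 1)(J - 1) ([generically_not_special]).

    The image of a polynomial map from a space of smaller dimension satisfies a
    nontrivial polynomial equation ([algebraic_dependence], proved by comparing
    the sizes of two interpolation grids), and the zero set of a nonzero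
    polynomial is negligible ([polyfun_zeros_null_or_full], by Fubini).  The proofs
    draw on the measure only through the facts that points are null sets and that
    the field operations are measurable, so the real and the complex case are
    treated together. *)

Set Implicit Arguments.
Unset Strict Implicit.
Unset Printing Implicit Defensive.

Import Order.TTheory GRing.Theory Num.Theory.

Local Open Scope ring_scope.

(** * Polynomial functions in finitely many variables *)

Section PolynomialFunctions.
Context {F : numFieldType}.

(** Polynomials are represented by the functions that they define, so that no
    bookkeeping of monomials is needed: degrees and zeros are read off from the
    restrictions to lines. *)
Inductive polyfun (X : Type) : ((X -> F) -> F) -> Prop :=
| polyfun_cst c : polyfun (fun _ => c)
| polyfun_var x : polyfun (fun v => v x)
| polyfun_add g h : polyfun g -> polyfun h -> polyfun (fun v => g v + h v)
| polyfun_mul g h : polyfun g -> polyfun h -> polyfun (fun v => g v * h v).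

Lemma eq_polyfun (X : Type) (g h : (X -> F) -> F) :
  (forall v, g v = h v) -> polyfun g -> polyfun h.
Proof. by move=> /funext ->. Qed.

Lemma polyfun_sum (X I : Type) (s : seq I) (p : pred I) (g : I -> (X -> F) -> F) :
  (forall i, p i -> polyfun (g i)) -> polyfun (fun v => \sum_(i <- s | p i) g i v).
Proof.
move=> gP; elim: s => [|i s IH].
  by apply: (eq_polyfun _ (polyfun_cst _ 0)) => v; rewrite big_nil.
case pi: (p i); last by apply: (eq_polyfun _ IH) => v; rewrite big_cons pi.
by apply: (eq_polyfun _ (polyfun_add (gP i pi) IH)) => v; rewrite big_cons pi.
Qed.

Lemma polyfun_prod (X I : Type) (s : seq I) (p : pred I) (g : I -> (X -> F) -> F) :
  (forall i, p i -> polyfun (g i)) -> polyfun (fun v => \prod_(i <- s | p i) g i v).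
Proof.
move=> gP; elim: s => [|i s IH].
  by apply: (eq_polyfun _ (polyfun_cst _ 1)) => v; rewrite big_nil.
case pi: (p i); last by apply: (eq_polyfun _ IH) => v; rewrite big_cons pi.
by apply: (eq_polyfun _ (polyfun_mul (gP i pi) IH)) => v; rewrite big_cons pi.
Qed.

Lemma polyfun_sub (X : Type) (g h : (X -> F) -> F) :
  polyfun g -> polyfun h -> polyfun (fun v => g v - h v).
Proof.
move=> gP hP; have NhP := polyfun_mul (polyfun_cst X (-1)) hP.
apply: (eq_polyfun _ (polyfun_add gP NhP)) => v.
by rewrite mulN1r.
Qed.

Lemma polyfun_det (X : Type) n (M : (X -> F) -> 'M[F]_n) :
  (forall i j, polyfun (fun v => M v i j)) -> polyfun (fun v => \det (M v)).
Proof.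
move=> MP; rewrite /determinant; apply: polyfun_sum => s _.
apply: polyfun_mul; first exact: polyfun_cst.
by apply: polyfun_prod => i _; exact: MP.
Qed.

Lemma polyfun_adj (X : Type) n (M : (X -> F) -> 'M[F]_n) i j :
  (forall i j, polyfun (fun v => M v i j)) -> polyfun (fun v => (\adj (M v)) i j).
Proof.
move=> MP; pose g v := (-1) ^+ (j + i) * \det (row' j (col' i (M v))).
apply: (@eq_polyfun _ g) => [v|]; first by rewrite mxE.
apply: polyfun_mul; first exact: polyfun_cst.
apply: polyfun_det => k l.
by apply: (eq_polyfun _ (MP (lift j k) (lift i l))) => v; rewrite !mxE.
Qed.

Lemma polyfun_comp (X Y : Type) (g : (Y -> F) -> F) (f : Y -> (X -> F) -> F) :
  polyfun g -> (forall y, polyfun (f y)) -> polyfun (fun v => g (f^~ v)).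
Proof.
move=> gP fP; elim: gP => [c|y|g1 g2 _ IH1 _ IH2|g1 g2 _ IH1 _ IH2].
- exact: polyfun_cst.
- exact: fP.
- exact: polyfun_add.
- exact: polyfun_mul.
Qed.

Definition update (X : eqType) (v : X -> F) x t := fun y => if y == x then t else v y.

(** Degree at most [d] in each variable separately, as a property of the function:
    this is all that interpolation on a grid uses. *)
Definition multideg_le (X : eqType) d (g : (X -> F) -> F) :=
  forall v x, exists2 p : {poly F}, (size p <= d.+1)%N &
    forall t, g (update v x t) = p.[t].

Lemma eq_multideg_le (X : eqType) d (g h : (X -> F) -> F) :
  (forall v, g v = h v) -> multideg_le d g -> multideg_le d h.
Proof. by move=> /funext ->. Qed.

Lemma multideg_leW (X : eqType) d e (g : (X -> F) -> F) :
  (d <= e)%N -> multideg_le d g -> multideg_le e g.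
Proof.
move=> de gd v x; have [p sp gp] := gd v x.
by exists p => //; exact: leq_trans sp _.
Qed.

Lemma multideg_le_cst (X : eqType) c : multideg_le 0 (fun _ : X -> F => c).
Proof. by move=> v x; exists c%:P => [|t]; rewrite ?hornerC// size_polyC leq_b1. Qed.

Arguments multideg_le_cst X c : clear implicits.

Lemma multideg_le_add (X : eqType) d (g h : (X -> F) -> F) :
  multideg_le d g -> multideg_le d h -> multideg_le d (fun v => g v + h v).
Proof.
move=> gd hd v x; have [p sp gp] := gd v x; have [q sq hq] := hd v x.
exists (p + q) => [|t]; last by rewrite hornerD gp hq.
by rewrite (leq_trans (size_polyD _ _))// geq_max sp.
Qed.

Lemma multideg_le_mul (X : eqType) d e (g h : (X -> F) -> F) :
  multideg_le d g -> multideg_le e h -> multideg_le (d + e) (fun v => g v * h v).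
Proof.
move=> gd hd v x; have [p sp gp] := gd v x; have [q sq hq] := hd v x.
exists (p * q) => [|t]; last by rewrite hornerM gp hq.
by have := size_polyMleq p q; lia.
Qed.

Lemma multideg_le_sum (X : eqType) I (s : seq I) (p : pred I) d (g : I -> (X -> F) -> F) :
  (forall i, multideg_le d (g i)) -> multideg_le d (fun v => \sum_(i <- s | p i) g i v).
Proof.
move=> gP; elim: s => [|i s IH].
  have c0 := multideg_leW (leq0n d) (multideg_le_cst X 0).
  by apply: (eq_multideg_le _ c0) => v; rewrite big_nil.
case pi: (p i); last by apply: (eq_multideg_le _ IH) => v; rewrite big_cons pi.
by apply: (eq_multideg_le _ (multideg_le_add (gP i) IH)) => v; rewrite big_cons pi.
Qed.

Lemma multideg_le_prod (X : eqType) I (s : seq I) (p : pred I) d (g : I -> (X -> F) -> F) :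
  (forall i, multideg_le d (g i)) ->
  multideg_le (\sum_(i <- s | p i) d) (fun v => \prod_(i <- s | p i) g i v).
Proof.
move=> gP; elim: s => [|i s IH].
  rewrite big_nil.
  by apply: (eq_multideg_le _ (multideg_le_cst _ 1)) => v; rewrite big_nil.
rewrite big_cons; case pi: (p i); last first.
  by apply: (eq_multideg_le _ IH) => v; rewrite big_cons pi.
by apply: (eq_multideg_le _ (multideg_le_mul (gP i) IH)) => v; rewrite big_cons pi.
Qed.

Lemma polyfun_multideg (X : eqType) (g : (X -> F) -> F) :
  polyfun g -> exists d, multideg_le d g.
Proof.
elim=> [c|x|g1 g2 _ [d1 H1] _ [d2 H2]|g1 g2 _ [d1 H1] _ [d2 H2]].
- by exists 0%N; exact: multideg_le_cst.
- exists 1%N => v y; rewrite /update; case: eqP => _.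
    by exists 'X => [|t]; rewrite ?size_polyX ?hornerX.
  by exists (v x)%:P => [|t]; rewrite ?hornerC// size_polyC; case: (_ != _).
- exists (maxn d1 d2); apply: multideg_le_add.
    exact: multideg_leW (leq_maxl _ _) H1.
  exact: multideg_leW (leq_maxr _ _) H2.
- by exists (d1 + d2)%N; exact: multideg_le_mul.
Qed.

Lemma grid_roots_eq0 d (p : {poly F}) : (size p <= d.+1)%N ->
  (forall i : 'I_d.+1, p.[i%:R] = 0) -> p = 0.
Proof.
move=> sp p0; apply/eqP; apply: contraTT sp => pn0; rewrite -ltnNge.
rewrite -(size_enum_ord d.+1) -(size_map (fun i : 'I__ => i%:R : F)).
apply: max_poly_roots => //.
  by apply/allP => _ /mapP[i _ ->]; rewrite rootE p0.
by rewrite map_inj_uniq ?enum_uniq// => i j /eqP; rewrite eqr_nat => /eqP/val_inj.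
Qed.

(** The coordinates are released from the grid one at a time: along each of them
    the function is a polynomial of degree at most [d] with [d.+1] zeros. *)
Lemma multideg_grid_eq0 (X : finType) d (g : (X -> F) -> F) : multideg_le d g ->
  (forall a : {ffun X -> 'I_d.+1}, g (fun x => (a x)%:R) = 0) -> forall v, g v = 0.
Proof.
move=> gd g0.
suff H (s : seq X) v : (forall y, y \notin s -> exists i : 'I_d.+1, v y = i%:R) -> g v = 0.
  by move=> v; apply: (H (enum X)) => y; rewrite mem_enum.
elim: s v => [|x s IH] v vP.
  have [a aE] := choice (fun y => vP y isT).
  by rewrite -(g0 (finfun a)); congr g; apply/funext => y; rewrite ffunE.
have [p sp gp] := gd v x.
have -> : v = update v x (v x) by apply/funext => y; rewrite /update; case: eqP => [->|].
rewrite gp (grid_roots_eq0 sp) ?horner0// => i; rewrite -gp; apply: IH => y ys.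
rewrite /update; case: eqVneq => [_|yx]; first by exists i.
by apply: vP; rewrite inE negb_or yx.
Qed.

(** The Lagrange polynomial of a grid point, up to a nonzero constant. *)
Definition node_poly D (a : 'I_D.+1) (t : F) := \prod_(b < D.+1 | b != a) (t - b%:R).

Lemma node_poly_eq0 D (a b : 'I_D.+1) : (node_poly a b%:R == 0) = (a != b).
Proof.
rewrite /node_poly; apply/idP/idP.
  case/prodf_eq0 => c ca; rewrite subr_eq0 eqr_nat => /eqP/val_inj bc.
  by rewrite bc eq_sym.
by rewrite eq_sym => ab; rewrite (bigD1 b)//= subrr mul0r.
Qed.

(** Look for [P] among the combinations of the products of Lagrange polynomials on
    the grid [{0, ..., D}^Y].  They form a space of dimension [(D + 1) ^ #|Y|], and
    they are independent because each is nonzero at exactly one grid point.  The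
    composite of such a [P] with [f] has degree at most [E = O(D)] in each variable,
    hence it vanishes as soon as it vanishes on a grid with [(E + 1) ^ #|X|] points.
    For large [D] these linear conditions are fewer than the unknowns. *)
Lemma algebraic_dependence (X Y : finType) (f : Y -> (X -> F) -> F) :
  (forall y, polyfun (f y)) -> (#|X| < #|Y|)%N ->
  exists P : (Y -> F) -> F, [/\ polyfun P, exists w, P w != 0 &
    forall v, P (f^~ v) = 0].
Proof.
move=> fP XY; set n := #|X|; set N := #|Y|.
have [c fc] : exists c, forall y, multideg_le c (f y).
  have [c cP] := choice (fun y => polyfun_multideg (fP y)).
  by exists (\max_y c y) => y; exact: multideg_leW (leq_bigmax y) (cP y).
pose D := ((c * N).+1 ^ n)%N; pose E := (N * (D * c))%N.
pose U := {ffun Y -> 'I_D.+1}; pose V := {ffun X -> 'I_E.+1}.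
have D0 : (0 < D)%N by rewrite expn_gt0.
(* For this D, (E + 1)^n <= ((c N + 1) D)^n = D^(n + 1) < (D + 1)^N. *)
have VU : (#|{: V}| < #|{: U}|)%N.
  rewrite !card_ffun !card_ord -/n -/N.
  apply: (@leq_ltn_trans (D ^ n.+1)%N).
    have -> : (D ^ n.+1 = ((c * N).+1 * D) ^ n)%N by rewrite expnMn -/D -expnS.
    have : (E.+1 <= (c * N).+1 * D)%N by rewrite /E; nia.
    by case: (n) => // k ED; rewrite leq_exp2r.
  apply: (@leq_ltn_trans (D ^ N)%N); first by rewrite leq_pexp2l.
  by rewrite ltn_exp2r ?(leq_ltn_trans _ XY).
pose L (a : U) (w : Y -> F) := \prod_y node_poly (a y) (w y).
pose M := \matrix_(i < #|{: U}|, j < #|{: V}|)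
  L (enum_val i) (f^~ (fun x => (enum_val j x)%:R)).
have [k kM k0] : exists2 k : 'rV[F]_#|{: U}|, k *m M = 0 & k != 0.
  have : kermx M != 0.
    rewrite kermx_eq0 /row_free neq_ltn; apply/orP; left.
    exact: leq_ltn_trans (rank_leq_col M) VU.
  case/rowV0Pn => k /sub_kermxP kM k0; by exists k.
pose P w := \sum_i k 0 i * L (enum_val i) w.
have LP a : polyfun (L a).
  apply: polyfun_prod => y _; apply: polyfun_prod => b _.
  by apply: polyfun_sub; [exact: polyfun_var|exact: polyfun_cst].
exists P; split.
- by apply: polyfun_sum => i _; apply: polyfun_mul; [exact: polyfun_cst|exact: LP].
- have [i ki] : exists i, k 0 i != 0 by apply/rV0Pn.
  exists (fun y => (enum_val i y)%:R); rewrite /P (bigD1 i)//= big1 ?addr0.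
    rewrite mulf_neq0//; apply/prodf_neq0 => y _.
    by rewrite node_poly_eq0 negbK.
  move=> j ji; apply/eqP; rewrite mulf_eq0; apply/orP; right.
  have /eqP ne : enum_val j != enum_val i :> U by rewrite (inj_eq enum_val_inj).
  have /existsNP[y /eqP yP] : ~ forall y, enum_val j y = enum_val i y by move=> /ffunP.
  by apply/prodf_eq0; exists y => //; rewrite node_poly_eq0.
- apply: (@multideg_grid_eq0 _ E).
    apply: multideg_le_sum => i; rewrite -[E]add0n.
    apply: multideg_le_mul; first exact: multideg_le_cst.
    have -> : E = (\sum_(y : Y) (D * c))%N by rewrite sum_nat_const.
    apply: multideg_le_prod => y.
    have -> : (D * c = \sum_(b < D.+1 | b != enum_val i y) c)%N.
      by rewrite (sum_nat_const (predC1 (enum_val i y))) cardC1 card_ord.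
    apply: multideg_le_prod => b; apply: multideg_le_add => //.
    exact: multideg_leW (multideg_le_cst _ _).
  move=> a; move/rowP : kM => /(_ (enum_rank a)); rewrite !mxE => <-.
  by apply: eq_bigr => i _; rewrite mxE enum_rankK.
Qed.

End PolynomialFunctions.

(** * Properties that hold off the zero set of a nonzero polynomial *)

Section Generic.
Context {F : numFieldType}.

Lemma polyfun_line (X : Type) (g : (X -> F) -> F) (v w : X -> F) : polyfun g ->
  exists p : {poly F}, forall t, g (fun x => v x + t * (w x - v x)) = p.[t].
Proof.
elim=> [c|x|g1 g2 _ [p1 E1] _ [p2 E2]|g1 g2 _ [p1 E1] _ [p2 E2]].
- by exists c%:P => t; rewrite hornerC.
- by exists ((v x)%:P + 'X * (w x - v x)%:P) => t; rewrite !hornerE.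
- by exists (p1 + p2) => t; rewrite E1 E2 hornerD.
- by exists (p1 * p2) => t; rewrite E1 E2 hornerM.
Qed.

Lemma poly_nonroot (p : {poly F}) : p != 0 -> exists t, p.[t] != 0.
Proof.
move=> p0; apply: contrapT => H; move/negP : p0; apply; apply/eqP.
apply: (@grid_roots_eq0 _ (size p)) => [|i]; first exact: leqnSn.
by apply: contrapT => /eqP pi; apply: H; exists i%:R.
Qed.

(** Nonzero values of [g] at [v] and of [h] at [w] make both restrictions to the
    line through [v] and [w] nonzero, and univariate polynomials over a field form
    an integral domain. *)
Lemma polyfun_mul_neq0 (X : Type) (g h : (X -> F) -> F) :
  polyfun g -> polyfun h -> (exists v, g v != 0) -> (exists w, h w != 0) ->
  exists v, g v * h v != 0.
Proof.
move=> gP hP [v gv] [w hw].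
have [p pE] := polyfun_line v w gP; have [q qE] := polyfun_line v w hP.
have p0 : p != 0.
  apply: contraNneq gv => p0; have := pE 0; rewrite p0 horner0 => <-.
  by apply/eqP; congr g; apply/funext => x; rewrite mul0r addr0.
have q0 : q != 0.
  apply: contraNneq hw => q0; have := qE 1; rewrite q0 horner0 => <-.
  by apply/eqP; congr h; apply/funext => x; rewrite mul1r addrC subrK.
have [t] := poly_nonroot (mulf_neq0 p0 q0); rewrite hornerM -pE -qE => pqt.
by eexists; exact: pqt.
Qed.

(** [P] holds on a nonempty Zariski open set, which is taken to be the complement
    of one hypersurface. *)
Definition generically (X : Type) (P : (X -> F) -> Prop) :=
  exists g, [/\ polyfun g, exists v, g v != 0 & forall v, g v != 0 -> P v].

Lemma generically_neq0 (X : Type) (g : (X -> F) -> F) :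
  polyfun g -> (exists v, g v != 0) -> generically (fun v => g v != 0).
Proof. by move=> gP g0; exists g. Qed.

Lemma generically_sub (X : Type) (P Q : (X -> F) -> Prop) :
  (forall v, P v -> Q v) -> generically P -> generically Q.
Proof. by move=> PQ [g [gP g0 gE]]; exists g; split=> // v /gE/PQ. Qed.

Lemma generically_all (X : Type) (P : (X -> F) -> Prop) :
  (forall v, P v) -> generically P.
Proof.
move=> PT; exists (fun=> 1); split=> //; first exact: polyfun_cst.
by exists (fun=> 0); exact: oner_neq0.
Qed.

Lemma generically_and (X : Type) (P Q : (X -> F) -> Prop) :
  generically P -> generically Q -> generically (fun v => P v /\ Q v).
Proof.
move=> [g [gP g0 gE]] [h [hP h0 hE]]; exists (fun v => g v * h v); split.
- exact: polyfun_mul.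
- exact: polyfun_mul_neq0.
- by move=> v; rewrite mulf_eq0 negb_or => /andP[/gE ? /hE ?].
Qed.

Lemma generically_forall (X : Type) (T : finType) (P : T -> (X -> F) -> Prop) :
  (forall t, generically (P t)) -> generically (fun v => forall t, P t v).
Proof.
move=> PG.
suff : generically (fun v => forall t, t \in enum T -> P t v).
  by apply: generically_sub => v Pv t; apply: Pv; rewrite mem_enum.
elim: (enum T) => [|t s IH]; first exact: generically_all.
apply: generically_sub (generically_and (PG t) IH) => v [Pt Ps] t'.
by rewrite inE => /orP[/eqP ->|/Ps].
Qed.

Lemma generically_imply (X : Type) (Q : Prop) (P : (X -> F) -> Prop) :
  (Q -> generically P) -> generically (fun v => Q -> P v).
Proof.
move=> QP; have [/QP|nQ] := pselect Q; first by apply: generically_sub.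
exact: generically_all.
Qed.

Lemma generically_comp (X Y : Type) (e : Y -> X) (P : (Y -> F) -> Prop) :
  (forall w : Y -> F, exists v : X -> F, v \o e = w) -> generically P ->
  generically (fun v => P (v \o e)).
Proof.
move=> eS [g [gP [w gw] gE]]; exists (fun v => g (v \o e)); split.
- by apply: (@polyfun_comp _ _ _ _ (fun y v => v (e y))) => // y; exact: polyfun_var.
- by have [v vw] := eS w; exists v; rewrite vw.
- by move=> v /gE.
Qed.

Lemma generically_inl (X Y : Type) (P : (X -> F) -> Prop) :
  generically P -> generically (fun v : X + Y -> F => P (v \o inl)).
Proof.
by apply: generically_comp => w; exists (fun s => if s is inl x then w x else 0).
Qed.

Lemma generically_inr (X Y : Type) (P : (Y -> F) -> Prop) :
  generically P -> generically (fun v : X + Y -> F => P (v \o inr)).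
Proof.
by apply: generically_comp => w; exists (fun s => if s is inr x then w x else 0).
Qed.

Definition mx_of m n (v : 'I_m * 'I_n -> F) : 'M[F]_(m, n) := \matrix_(i, j) v (i, j).

(** The minor is 1 at the 0-1 matrix with ones at the positions [(f p, g p)]. *)
Lemma generically_minor m n k (f : 'I_k -> 'I_m) (g : 'I_k -> 'I_n) :
  injective f -> injective g ->
  generically (fun v : 'I_m * 'I_n -> F => \det (mxsub f g (mx_of v)) != 0).
Proof.
move=> f_inj g_inj; apply: generically_neq0.
  apply: polyfun_det => i j.
  by apply: (eq_polyfun _ (polyfun_var (f i, g j))) => v; rewrite !mxE.
exists (fun ij => [exists p, (f p == ij.1) && (g p == ij.2)]%:R).
rewrite (_ : mxsub f g _ = 1%:M) ?det1 ?oner_neq0//.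
apply/matrixP => i j; rewrite !mxE /=; congr (nat_of_bool _)%:R.
apply/existsP/eqP => [[p /andP[/eqP/f_inj <- /eqP/g_inj <-]]//|<-].
by exists i; rewrite !eqxx.
Qed.

End Generic.

(** * Uniqueness for factors whose span has no further matrix of rank 1 *)

Section Uniqueness.
Context {F : fieldType} {I J : nat}.

(** The transpose of the Khatri-Rao product of [A] and [B]: row [l] lists the
    entries of [a_l b_l^T]. *)
Definition khatri_rao r (A : 'M[F]_(I, r)) (B : 'M[F]_(J, r)) : 'M[F]_(r, I * J) :=
  \matrix_l mxvec (col l A *m (col l B)^T).

Lemma khatri_raoE r (A : 'M[F]_(I, r)) (B : 'M[F]_(J, r)) l i j :
  khatri_rao A B l (mxvec_index i j) = A i l * B j l.
Proof. by rewrite mxE mxvecE !mxE big_ord1 !mxE. Qed.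

(** The span of the points [a_l b_l^T] of the Segre variety meets that variety only
    in the given points. *)
Definition segre_general r (A : 'M[F]_(I, r)) (B : 'M[F]_(J, r)) :=
  forall (d : 'I_r -> F) (x : 'I_I -> F) (y : 'I_J -> F),
    (forall i j, \sum_l d l * (A i l * B j l) = x i * y j) ->
    forall l l', l != l' -> d l * d l' = 0.

(** The frontal slices of the tensor, vectorised as rows: in this form a polyadic
    decomposition is a matrix factorisation. *)
Definition flatten K (T : tensor F I J K) : 'M[F]_(K, I * J) :=
  \matrix_k mxvec (\matrix_(i, j) T (i, j, k)).

Lemma flatten_polyadic K r (A : 'M[F]_(I, r)) (B : 'M[F]_(J, r)) (C : 'M[F]_(K, r)) :
  flatten (polyadic A B C) = C *m khatri_rao A B.
Proof.
apply/matrixP => k q; case/mxvec_indexP: q => i j.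
rewrite mxE mxvecE !mxE sum_ffunE; apply: eq_bigr => l _.
by rewrite khatri_raoE ffunE !mxE /= mulrC.
Qed.

Lemma rank1_decomposition_polyadic K (T : tensor F I J K) s n :
  rank1_decomposition T s -> size s = n ->
  exists (A : 'M[F]_(I, n)) (B : 'M[F]_(J, n)) (C : 'M[F]_(K, n)),
    s = [seq outer (col p A) (col p B) (col p C) | p <- enum 'I_n] /\
    T = polyadic A B C.
Proof.
move=> [s1 sT] sn.
have /choice[f fP] : forall p : 'I_n,
    exists abc : 'cV[F]_I * 'cV[F]_J * 'cV[F]_K,
      nth 0 s p = outer abc.1.1 abc.1.2 abc.2.
  move=> p; have /s1[a [b [c [_ _ _ E]]]] : nth 0 s p \in s by rewrite mem_nth// sn.
  by exists (a, b, c).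
exists (\matrix_(i, p) (f p).1.1 i 0), (\matrix_(i, p) (f p).1.2 i 0),
  (\matrix_(i, p) (f p).2 i 0).
set g := (fun p => outer _ _ _).
have gE p : g p = nth 0 s p.
  by rewrite fP /g; congr outer; apply/colP => i; rewrite !mxE.
have sE : s = [seq g p | p <- enum 'I_n].
  rewrite (eq_map gE) (map_comp (nth 0 s) val) val_enum_ord -sn.
  by rewrite -/(mkseq _ _) mkseq_nth.
by split=> //; rewrite -sT [in LHS]sE big_map big_enum.
Qed.

Lemma unitmx_row_neq0 r (Q : 'M[F]_r) :
  Q \in unitmx -> forall p, exists l, Q p l != 0.
Proof.
rewrite -row_free_unit => Qf p.
have /rV0Pn[l] : row p Q != 0.
  rewrite rowE mulmx_free_eq0//; apply/eqP => /rowP/(_ p)/eqP.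
  by rewrite !mxE !eqxx oner_eq0.
by rewrite mxE; exists l.
Qed.

Section General.
Variables (r : nat) (A : 'M[F]_(I, r)) (B : 'M[F]_(J, r)).
Hypotheses (r2 : (1 < r)%N) (ABgen : segre_general A B).

(** If [a_l b_l^T] were zero, then it could be added to any other term [a_l' b_l'^T]
    without changing it, which gives a matrix of rank at most 1 with two nonzero
    coefficients. *)
Lemma segre_general_neq0 l : exists i j, A i l * B j l != 0.
Proof.
have [l' ll'] : exists l', l' != l.
  have : (0 < #|predC1 l|)%N by rewrite cardC1 card_ord -ltnS prednK// ltnW.
  by case/card_gt0P => l' ?; exists l'.
apply: contrapT => H; have H0 i j : A i l * B j l = 0.
  by apply: contrapT => /eqP ?; apply: H; exists i, j.
pose d k : F := ((k == l) || (k == l'))%:R.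
have dE i j : \sum_k d k * (A i k * B j k) = A i l' * B j l'.
  rewrite (bigD1 l')//= (bigD1 l)/=; last by rewrite eq_sym.
  rewrite H0 mulr0 add0r /d eqxx orbT mul1r big1 ?addr0// => k.
  by move=> /andP[/negPf -> /negPf ->]; rewrite mul0r.
have /eqP := ABgen dE ll'.
by rewrite /d !eqxx orbT mulr1 oner_eq0.
Qed.

Lemma khatri_rao_free : row_free (khatri_rao A B).
Proof.
rewrite -kermx_eq0; apply/eqP/row_matrixP => p; rewrite row0.
set v := row p _.
have vK : v *m khatri_rao A B = 0 by rewrite -row_mul mulmx_ker row0.
have vE i j : \sum_l v 0 l * (A i l * B j l) = 0.
  move/rowP : vK => /(_ (mxvec_index i j)); rewrite !mxE => {2}<-.
  by apply: eq_bigr => l _; rewrite khatri_raoE.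
have v2 := @ABgen (v 0) (fun=> 0) (fun=> 0).
apply/rowP => l; rewrite [RHS]mxE; apply/eqP; apply: contraT => vl.
have [i [j ABl]] := segre_general_neq0 l.
suff /eqP : v 0 l * (A i l * B j l) = 0 by rewrite mulf_eq0 (negPf vl) (negPf ABl).
rewrite -(vE i j) (bigD1 l)//= big1 ?addr0// => k kl.
have /eqP := v2 (fun i j => etrans (vE i j) (esym (mul0r 0))) _ _ kl.
by rewrite mulf_eq0 (negPf vl) orbF => /eqP ->; rewrite mul0r.
Qed.

Section ThirdFactor.
Variables (K : nat) (C : 'M[F]_(K, r)) (G : 'M[F]_(r, K)).
Hypothesis GC : G *m C = 1%:M.

(** The flattening of the tensor has the rank [r] of [khatri_rao A B], and a
    decomposition with [n] terms factors it through dimension [n]. *)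
Lemma polyadic_size_ge n (A' : 'M[F]_(I, n)) (B' : 'M[F]_(J, n)) (C' : 'M[F]_(K, n)) :
  polyadic A B C = polyadic A' B' C' -> (r <= n)%N.
Proof.
move=> /(congr1 (@flatten _)); rewrite !flatten_polyadic => E.
rewrite -{1}(eqP khatri_rao_free) -[khatri_rao _ _]mul1mx -GC -mulmxA E mulmxA.
exact: mulmx_max_rank.
Qed.

(** With as many terms, the change of basis [Q] between the two Khatri-Rao products
    is invertible.  Its rows express points of the Segre variety in the span of the
    [a_l b_l^T], so by general position each row has a single nonzero entry: [Q] is
    a monomial matrix, and its permutation matches the terms. *)
Lemma polyadic_terms_unique (A' : 'M[F]_(I, r)) (B' : 'M[F]_(J, r)) (C' : 'M[F]_(K, r)) :
  polyadic A B C = polyadic A' B' C' ->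
  exists2 f : 'I_r -> 'I_r, injective f & forall p,
    outer (col p A') (col p B') (col p C') =
    outer (col (f p) A) (col (f p) B) (col (f p) C).
Proof.
move=> /(congr1 (@flatten _)); rewrite !flatten_polyadic => E.
set N := khatri_rao A B in E; set N' := khatri_rao A' B' in E.
have NH : N = G *m C' *m N' by rewrite -mulmxA -E mulmxA GC mul1mx.
have Hu : G *m C' \in unitmx.
  rewrite -row_free_unit /row_free eqn_leq rank_leq_row /=.
  by have := mxrankM_maxl (G *m C') N'; rewrite -NH (eqP khatri_rao_free).
pose Q := invmx (G *m C').
have N'E : N' = Q *m N by rewrite NH mulKmx.
have Qu : Q \in unitmx by rewrite unitmx_inv.
have CE : C = C' *m Q.
  apply: (row_free_inj khatri_rao_free); rewrite /= -/N -mulmxA -N'E; exact: E.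
have N'ij p i j : A' i p * B' j p = \sum_l Q p l * (A i l * B j l).
  by rewrite -khatri_raoE -/N' N'E mxE; apply: eq_bigr => l _; rewrite khatri_raoE.
have Q1 p l l' : l != l' -> Q p l * Q p l' = 0.
  by apply: (@ABgen (Q p) (A'^~ p) (B'^~ p)) => i j; rewrite -N'ij.
have /choice[f fQ] := unitmx_row_neq0 Qu.
have Qf p l : l != f p -> Q p l = 0.
  by move=> /(Q1 p)/eqP; rewrite mulf_eq0 (negPf (fQ p)) orbF => /eqP.
have f_inj : injective f.
  move: Qu; rewrite -unitmx_tr => /unitmx_row_neq0/choice[g gQ].
  have gf : cancel g f.
    move=> l; apply/eqP; apply: contraR (gQ l) => lf.
    by rewrite mxE Qf// eq_sym.
  exact: bij_inj (bij_can_bij (injF_bij (can_inj gf)) gf).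
exists f => // p; apply/ffunP => -[[i j] k]; rewrite !ffunE !mxE /= N'ij.
rewrite (bigD1 (f p))//= big1 ?addr0 => [|l /Qf ->]; last by rewrite mul0r.
rewrite [in RHS]CE mxE (bigD1 p)//= big1 ?addr0 => [|q qp]; first by ring.
by rewrite Qf ?mulr0// (inj_eq f_inj) eq_sym.
Qed.

Lemma CPD_unique_of_segre_general : CPD_unique (polyadic A B C).
Proof.
pose t l := outer (col l A) (col l B) (col l C).
have t_dec : rank1_decomposition (polyadic A B C) [seq t l | l <- enum 'I_r].
  split; last by rewrite big_map big_enum.
  move=> _ /mapP[l _ ->]; exists (col l A), (col l B), (col l C).
  have [i [j]] := segre_general_neq0 l; rewrite mulf_eq0 negb_or => /andP[Ai Bj].
  split=> //.
  - by apply: contraNneq Ai => /colP/(_ i); rewrite !mxE => ->.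
  - by apply: contraNneq Bj => /colP/(_ j); rewrite !mxE => ->.
  - apply/eqP => /colP C0; move/matrixP : GC => /(_ l l)/eqP.
    rewrite !mxE eqxx big1 => [|k _]; first by rewrite eq_sym oner_eq0.
    by have := C0 k; rewrite !mxE => ->; rewrite mulr0.
have min_r s : rank1_decomposition (polyadic A B C) s -> (r <= size s)%N.
  move=> sd; have [A' [B' [C' [_]]]] := rank1_decomposition_polyadic sd erefl.
  exact: polyadic_size_ge.
have sz : size [seq t l | l <- enum 'I_r] = r by rewrite size_map size_enum_ord.
exists [seq t l | l <- enum 'I_r].
  by split=> //; split; [exists [seq t l | l <- enum 'I_r]|rewrite sz].
move=> s [sd [_ s_min]].
have sr : size s = r.
  by apply/eqP; rewrite eqn_leq min_r// -[X in (_ <= X)%N]sz s_min.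
have [A' [B' [C' [sE TE]]]] := rank1_decomposition_polyadic sd sr.
have [f f_inj fE] := polyadic_terms_unique TE.
rewrite sE (eq_map fE) (map_comp t f); apply: perm_map; apply: uniq_perm.
- by rewrite map_inj_uniq// enum_uniq.
- exact: enum_uniq.
- move=> l; rewrite mem_enum; apply/mapP; have [g gf fg] := injF_bij f_inj.
  by exists (g l); rewrite ?mem_enum.
Qed.

End ThirdFactor.
End General.
End Uniqueness.

(** * Generic position with respect to the Segre variety *)

Section Segre.
Context {F : numFieldType}.
Variables (I J r : nat).
Let ABindex := ('I_I * 'I_r + 'I_J * 'I_r)%type.
Implicit Types (w : ABindex -> F).
Let mxA w : 'M[F]_(I, r) := mx_of (w \o inl).
Let mxB w : 'M[F]_(J, r) := mx_of (w \o inr).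

(** Here a matrix of rank at most 1 is a combination of the [a_l b_l^T] whose
    coefficients at [l0] and at the image of [u] are nonzero. *)
Section SpecialPosition.
Variables (u : 'I_J -> 'I_r) (l0 : 'I_r) (i0 : 'I_I).
Hypotheses (u_inj : injective u) (rIJ : (r <= (I - 1) * (J - 1))%N).
Let W := [set u k | k in 'I_J].
Hypothesis l0W : l0 \notin W.

Let free := {l : 'I_r | l \notin W}.
Let free1 := {l : 'I_r | (l \notin W) && (l != l0)}.
Let row1 := {i : 'I_I | i != i0}.
(* The parameters: B, the columns of A outside W, the coefficients d_l with l
   outside W and l != l0, the J reciprocals of d_(u k) det(b_(u 1), ..., b_(u J)),
   the entries of x other than x_i0, and y. *)
Let param := ('I_J * 'I_r + 'I_I * free + free1 + 'I_J + row1 + 'I_J)%type.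

(* The dimension count: the bound r <= (I - 1)(J - 1) is exactly what is needed. *)
Let card_param : (#|{: param}| < #|{: ABindex}|)%N.
Proof.
rewrite !card_sum !card_prod !card_sig !card_ord.
have cW : #|W| = J by rewrite card_imset// card_ord.
have c1 : #|[pred l | l \notin W]| = (r - J)%N.
  have := cardC W; rewrite cW card_ord.
  rewrite (_ : #|[predC W]| = #|[pred l | l \notin W]|); first by move=> *; lia.
  by apply: eq_card => l; rewrite !inE.
have c2 : #|[pred l | (l \notin W) && (l != l0)]| = (r - J).-1.
  rewrite -c1 (cardD1 l0 [pred l | l \notin W]) inE l0W.
  by apply: eq_card => l; rewrite !inE andbC.
have c3 : #|[pred i | i != i0]| = I.-1 by have := cardC1 i0; rewrite card_ord.
rewrite c1 c2 c3.
have : (J < r)%N.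
  by have := max_card (pred_of_set (l0 |: W)); rewrite cardsU1 l0W cW card_ord.
have : (0 < I)%N by exact: leq_ltn_trans (ltn_ord i0).
move: rIJ; nia.
Qed.

Let pB j l : param := inl (inl (inl (inl (inl (j, l))))).
Let pA i (l : free) : param := inl (inl (inl (inl (inr (i, l))))).
Let pD (l : free1) : param := inl (inl (inl (inr l))).
Let pE k : param := inl (inl (inr k)).
Let pX (i : row1) : param := inl (inr i).
Let pY j : param := inr j.

(* The vectors and coefficients encoded by the parameters; the default values are
   the normalisations d_l0 = 1 and x_i0 = 1, and 0 removes from the sum in valM the
   columns of A that are to be solved for. *)
Let valA (v : param -> F) i l := if insub l is Some l' then v (pA i l') else 0.
Let valD (v : param -> F) l := if insub l is Some l' then v (pD l') else 1.
Let valX (v : param -> F) i := if insub i is Some i' then v (pX i') else 1.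
Let valM v i j := valX v i * v (pY j) - \sum_l valD v l * (valA v i l * v (pB j l)).
Let valBu (v : param -> F) : 'M[F]_J := \matrix_(j, k) v (pB j (u k)).

(* Cramer's rule for the columns of A in W.  The division by the determinant is
   part of the parameter pE, which keeps the map polynomial. *)
Let f (s : ABindex) (v : param -> F) : F :=
  match s with
  | inr (j, l) => v (pB j l)
  | inl (i, l) =>
    if [pick k | u k == l] is Some k then
      v (pE k) * \sum_j valM v i j * (\adj (valBu v)) k j
    else valA v i l
  end.

Let polyfun_valA i l : polyfun (fun v => valA v i l).
Proof. by rewrite /valA; case: insub => [l'|]; constructor. Qed.

Let polyfun_f s : polyfun (f s).
Proof.
case: s => -[i l]; rewrite /f /=; last exact: polyfun_var.
case: pickP => [k _|_]; last exact: polyfun_valA.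
apply: polyfun_mul; first exact: polyfun_var.
apply: polyfun_sum => j _; apply: polyfun_mul; last first.
  apply: polyfun_adj => j' k'.
  by apply: (eq_polyfun _ (polyfun_var (pB j' (u k')))) => v; rewrite mxE.
apply: polyfun_sub.
  by apply: polyfun_mul; [rewrite /valX; case: insub => [i'|]|]; constructor.
apply: polyfun_sum => l' _; apply: polyfun_mul.
  by rewrite /valD; case: insub => [i'|]; constructor.
by apply: polyfun_mul => //; constructor.
Qed.

Let f_surj (A : 'M[F]_(I, r)) (B : 'M[F]_(J, r)) d x y :
  (forall i j, \sum_l d l * (A i l * B j l) = x i * y j) ->
  \det (colsub u B) != 0 -> (forall k, d (u k) != 0) -> d l0 = 1 -> x i0 = 1 ->
  exists v, forall s, f s v =
    match s with inl il => A il.1 il.2 | inr jl => B jl.1 jl.2 end.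
Proof.
move=> ABd Bu du d1 x1.
pose v (p : param) : F := match p with
  | inl (inl (inl (inl (inl jl)))) => B jl.1 jl.2
  | inl (inl (inl (inl (inr il)))) => A il.1 (val il.2)
  | inl (inl (inl (inr l))) => d (val l)
  | inl (inl (inr k)) => (d (u k) * \det (colsub u B))^-1
  | inl (inr i) => x (val i)
  | inr j => y j
  end.
exists v; case=> -[i l] //; rewrite /f /=.
have vA l' : valA v i l' = if l' \in W then 0 else A i l'.
  by rewrite /valA; case: insubP => [[l'' h] /= /negPf -> -> //|]; rewrite negbK => ->.
have vX : valX v i = x i.
  by rewrite /valX; case: insubP => [[i' h] /= _ <- //|]; rewrite negbK => /eqP ->.
case: pickP => [k /eqP <-|nu]; last first.
  rewrite vA ifF//; apply/negbTE/imsetP => -[k _ lk].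
  by have := nu k; rewrite lk eqxx.
have vBu : valBu v = colsub u B by apply/matrixP => j k'; rewrite !mxE.
pose S := \matrix_(i, k) (d (u k) * A i (u k)).
have vM j : valM v i j = (S *m (colsub u B)^T) i j.
  rewrite /valM vX -ABd -sumrB mxE.
  rewrite (bigID (mem W))/= [X in _ + X]big1 ?addr0; last first.
    move=> l' l'W; rewrite vA (negPf l'W) /valD.
    case: insubP => [[l'' h] /= _ -> |]; first by rewrite subrr.
    by rewrite l'W /= negbK => /eqP ->; rewrite d1 subrr.
  rewrite big_imset/=; last by move=> ? ? _ _; exact: u_inj.
  apply: eq_bigr => k' _; rewrite !mxE vA imset_f// mul0r mulr0 subr0.
  by rewrite mulrA.
have -> : \sum_j valM v i j * (\adj (valBu v)) k j =
    (S *m (colsub u B)^T *m (\adj (colsub u B))^T) i k.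
  by rewrite mxE; apply: eq_bigr => j _; rewrite vM vBu !mxE.
rewrite -mulmxA -trmx_mul mul_adj_mx tr_scalar_mx mul_mx_scalar !mxE /=.
by field; rewrite Bu du.
Qed.

(** The pairs in special position lie in the image of [f], a polynomial map from
    a space of smaller dimension. *)
Lemma generically_not_special : generically (fun w => forall d x y,
  (forall i j, \sum_l d l * (mxA w i l * mxB w j l) = x i * y j) ->
  \det (colsub u (mxB w)) != 0 -> (forall k, d (u k) != 0) -> d l0 = 1 ->
  x i0 = 1 -> False).
Proof.
have [P [PP P0 Pf]] := algebraic_dependence polyfun_f card_param.
exists P; split=> // w /eqP Pw d x y ABd Bu du d1 x1; apply: Pw.
have [v fv] := f_surj ABd Bu du d1 x1.
rewrite -(Pf v); congr P; apply/funext => s; rewrite fv.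
by case: s => -[i j]; rewrite mxE.
Qed.

End SpecialPosition.

(** Listing the support of [d] first, the first [J] indices either exhaust the
    support or are contained in it with a further index to spare. *)
Lemma support_first (d : 'I_r -> F) (l : 'I_r) : (J <= r)%N ->
  exists2 u : 'I_J -> 'I_r, injective u &
    (forall l, d l != 0 -> l \in [set u k | k in 'I_J]) \/
    (forall k, d (u k) != 0) /\ exists2 l0, d l0 != 0 & l0 \notin [set u k | k in 'I_J].
Proof.
move=> Jr.
pose s1 := [seq k <- enum 'I_r | d k != 0].
pose s2 := [seq k <- enum 'I_r | ~~ (d k != 0)].
pose s := s1 ++ s2; pose u (k : 'I_J) := nth l s k.
have s_perm : perm_eq s (enum 'I_r) by exact: permEl (perm_filterC _ _).
have s_uniq : uniq s by rewrite (perm_uniq s_perm) enum_uniq.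
have s_size : size s = r by rewrite (perm_size s_perm) size_enum_ord.
have ks (k : 'I_J) : (k < size s)%N by rewrite s_size (leq_trans _ Jr).
have nth_s1 k : (k < size s1)%N -> d (nth l s k) != 0.
  move=> ks1; rewrite nth_cat ks1.
  by have := mem_nth l ks1; rewrite mem_filter => /andP[].
exists u.
  by move=> k k' /eqP; rewrite nth_uniq// => /eqP/val_inj.
have [s1J|Js1] := leqP (size s1) J; [left|right].
  move=> k dk; have ks1 : k \in s1 by rewrite mem_filter dk mem_enum.
  have kJ : (index k s < J)%N.
    by rewrite index_cat ks1 (leq_trans _ s1J)// index_mem.
  by apply/imsetP; exists (Ordinal kJ) => //; rewrite /u nth_index// mem_cat ks1.
split; first by move=> k; rewrite nth_s1// (leq_trans _ Js1)// ltnW// ltnS.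
have Js : (J < size s)%N by rewrite size_cat ltn_addr.
exists (nth l s J); first exact: nth_s1.
apply/imsetP => -[k _ /eqP]; rewrite /u nth_uniq// => /eqP Jk.
by have := ltn_ord k; rewrite -Jk ltnn.
Qed.

(** When the columns of [B] on the support of [d] are independent, the columns
    [d_l a_l] are all multiples of [x], so the minor of [A] on two of them is zero. *)
Lemma small_support_minor (A : 'M[F]_(I, r)) (B : 'M[F]_(J, r)) d x y
    (u : 'I_J -> 'I_r) (i1 i2 : 'I_I) l l' : injective u ->
  (forall i j, \sum_l d l * (A i l * B j l) = x i * y j) ->
  \det (colsub u B) != 0 ->
  (forall l, d l != 0 -> l \in [set u k | k in 'I_J]) ->
  A i1 l * A i2 l' - A i2 l * A i1 l' != 0 -> d l * d l' = 0.
Proof.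
move=> u_inj ABd Bu du Al.
have [->|dl] := eqVneq (d l) 0; first by rewrite mul0r.
have [->|dl'] := eqVneq (d l') 0; first by rewrite mulr0.
have /imsetP[k _ lk] := du _ dl; have /imsetP[k' _ lk'] := du _ dl'.
pose S := \matrix_(i, k) (d (u k) * A i (u k)).
have SE : S *m (colsub u B)^T = (\col_i x i) *m (\row_j y j).
  apply/matrixP => i j; rewrite !mxE big_ord1 !mxE -ABd.
  rewrite [RHS](bigID (mem [set u k | k in 'I_J]))/= [X in _ + X]big1 ?addr0; last first.
    move=> m; apply: contraNeq => dm; apply: du.
    by apply: contraNneq dm => ->; rewrite mul0r.
  rewrite big_imset/=; last by move=> ? ? _ _; exact: u_inj.
  by apply: eq_bigr => q _; rewrite !mxE mulrA.
have Buu : (colsub u B)^T \in unitmx by rewrite unitmx_tr unitmxE unitfE.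
have SE' i q : d (u q) * A i (u q) = x i * (\row_j y j *m invmx (colsub u B)^T) 0 q.
  have := congr1 (fun M => (M *m invmx (colsub u B)^T) i q) SE.
  by rewrite /= mulmxK// -mulmxA [RHS]mxE big_ord1 !mxE.
suff : d l * d l' * (A i1 l * A i2 l' - A i2 l * A i1 l') = 0.
  by move/eqP; rewrite mulf_eq0 (negPf Al) orbF => /eqP.
set z := _ *m _ in SE'.
transitivity (d l * A i1 l * (d l' * A i2 l') - d l * A i2 l * (d l' * A i1 l')).
  by ring.
by rewrite lk lk' !SE'; ring.
Qed.

(** Intersect three generic conditions: the minors of [B] of order [J] and the
    minors of [A] of order 2 on two fixed rows do not vanish, and no special
    position occurs. *)
Lemma generically_segre_general : (1 < I)%N -> (J <= r)%N ->
  (r <= (I - 1) * (J - 1))%N ->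
  generically (fun w => segre_general (mxA w) (mxB w)).
Proof.
move=> I2 Jr rIJ.
pose i1 : 'I_I := Ordinal (ltnW I2); pose i2 : 'I_I := Ordinal I2.
have gB : generically (fun w => forall u : {ffun 'I_J -> 'I_r}, injective u ->
    \det (colsub u (mxB w)) != 0).
  apply: generically_forall => u; apply: generically_imply => u_inj.
  exact: (@generically_inr F _ _ _ (generically_minor (@inj_id 'I_J) u_inj)).
have gA : generically (fun w => forall l l', l != l' ->
    mxA w i1 l * mxA w i2 l' - mxA w i2 l * mxA w i1 l' != 0).
  apply: generically_forall => l; apply: generically_forall => l'.
  apply: generically_imply => ll'; 
  apply: (@generically_inl F _ _ (fun v => mx_of v i1 l * mx_of v i2 l'
    - mx_of v i2 l * mx_of v i1 l' != 0)).
  apply: generically_neq0.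
    apply: (eq_polyfun _ (polyfun_sub
      (polyfun_mul (polyfun_var (i1, l)) (polyfun_var (i2, l')))
      (polyfun_mul (polyfun_var (i2, l)) (polyfun_var (i1, l'))))) => v.
    by rewrite !mxE.
  exists (fun il => ((il.2 == l) == (il.1 == i1))%:R); rewrite !mxE /=.
  have -> : (l' == l) = false by rewrite eq_sym (negPf ll').
  by rewrite !eqxx /= mulr1 mul0r subr0 oner_neq0.
have gS : generically (fun w => forall (u : {ffun 'I_J -> 'I_r}) l0 i0,
  injective u -> l0 \notin [set u k | k in 'I_J] -> forall d x y,
  (forall i j, \sum_l d l * (mxA w i l * mxB w j l) = x i * y j) ->
  \det (colsub u (mxB w)) != 0 -> (forall k, d (u k) != 0) -> d l0 = 1 ->
  x i0 = 1 -> False).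
  apply: generically_forall => u; apply: generically_forall => l0.
  apply: generically_forall => i0; apply: generically_imply => u_inj.
  by apply: generically_imply => l0u; exact: generically_not_special.
apply: generically_sub (generically_and gB (generically_and gA gS)).
move=> w [HB [HA HS]] d x y ABd l l' ll'.
have [u' u'_inj dsupp] := support_first d l Jr.
pose u := [ffun k => u' k].
have uE : u =1 u' by move=> k; rewrite ffunE.
have u_inj : injective u by move=> k k'; rewrite !uE => /u'_inj.
have Bu := HB u u_inj.
have WE : [set u' k | k in 'I_J] = [set u k | k in 'I_J].
  by apply: eq_imset => k; rewrite uE.
rewrite WE in dsupp; case: dsupp => [du|[du [l0 dl0 l0u]]].
  exact: (small_support_minor u_inj ABd Bu du (HA _ _ ll')).
exfalso.
(* If x = 0, then any nonzero vector may replace x, with y = 0. *)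
have [i0 [x' [y' [x1 xy]]]] : exists i0 x' y', x' i0 = 1 /\
    forall i j, x' i * y' j = x i * y j / d l0.
  have [[i0 xi0]|x0] := pselect (exists i0, x i0 != 0).
    exists i0, (fun i => x i / x i0), (fun j => x i0 * y j / d l0).
    split; first exact: divff.
    by move=> i j; field; rewrite dl0 xi0.
  exists i1, (fun=> 1), (fun=> 0); split=> // i j.
  have -> : x i = 0 by apply: contrapT => /eqP ?; apply: x0; exists i.
  by rewrite mulr0 !mul0r.
apply: (HS u l0 i0 u_inj l0u (fun l => d l / d l0) x' y') => //.
- move=> i j; rewrite xy -ABd mulr_suml; apply: eq_bigr => q _; ring.
- by move=> k; rewrite mulf_neq0 ?invr_eq0// uE.
- by rewrite divff.
Qed.

End Segre.

Definition factor_index (I J K r : nat) :=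
  ('I_I * 'I_r + 'I_J * 'I_r + 'I_K * 'I_r)%type.

Section Core.
Context {F : numFieldType}.
Variables (I J K r : nat).

Lemma generically_left_inverse : (r <= K)%N ->
  generically (fun v : 'I_K * 'I_r -> F => exists G : 'M[F]_(r, K), G *m mx_of v = 1%:M).
Proof.
move=> rK; pose h := @widen_ord _ _ rK.
have h_inj : injective h by move=> i j /(congr1 val) /= /val_inj.
apply: generically_sub (generically_minor h_inj (@inj_id 'I_r)) => v v0.
exists (invmx (rowsub h (mx_of v)) *m rowsub h 1%:M).
by rewrite -mulmxA -rowsubE mulVmx// unitmxE unitfE.
Qed.

Lemma generically_CPD_unique : (1 < I)%N -> (1 < r)%N -> (J <= r)%N -> (r <= K)%N ->
  (r <= (I - 1) * (J - 1))%N ->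
  generically (fun v : factor_index I J K r -> F =>
    CPD_unique (polyadic (mx_of (v \o inl \o inl)) (mx_of (v \o inl \o inr))
      (mx_of (v \o inr)))).
Proof.
move=> I2 r2 Jr rK rIJ.
have gAB := @generically_inl _ _ ('I_K * 'I_r) _
  (@generically_segre_general F _ _ _ I2 Jr rIJ).
have gC := @generically_inr _ ('I_I * 'I_r + 'I_J * 'I_r)%type _ _
  (generically_left_inverse rK).
apply: generically_sub (generically_and gAB gC) => v [ABgen [G GC]].
exact: (CPD_unique_of_segre_general r2 ABgen GC).
Qed.

End Core.

(** * Zero sets of polynomials are null *)

Local Open Scope classical_set_scope.

Section NullOrFull.
Context {R : realType}.

(** The dichotomy for zero sets of polynomials, isolated from the algebra: it
    passes from the lines parallel to the axes to the whole space by Fubini. *)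
Definition null_or_full d (T : measurableType d) (mu : set T -> \bar R) (Z : set T) :=
  mu Z = 0%E \/ Z = setT.

(** If [Z] misses [(x0, y0)], then for almost all [x] it misses [(x, y0)], and for
    those [x] the section at [x] is not full, hence it is null. *)
Lemma null_or_full_prod d1 d2 (T1 : measurableType d1) (T2 : measurableType d2)
    (m1 : {measure set T1 -> \bar R}) (m2 : {sigma_finite_measure set T2 -> \bar R})
    (Z : set (T1 * T2)) :
  measurable Z ->
  (forall y, null_or_full m1 [set x | Z (x, y)]) ->
  (forall x, null_or_full m2 [set y | Z (x, y)]) ->
  null_or_full (m1 \x m2)%E Z.
Proof.
move=> mZ Z1 Z2; have [->|ZT] := pselect (Z = setT); [by right|left].
have [[x0 y0] Z0] : exists xy, ~ Z xy.
  apply: contrapT => /forallNP H; apply: ZT; apply/seteqP; split=> // xy _.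
  exact: contrapT.
rewrite /product_measure1 -(integral0 m1 setT).
apply: ae_eq_integral => //; first exact: measurable_fun_xsection.
exists [set x | Z (x, y0)]; split.
- have <- : ysection Z y0 = [set x | Z (x, y0)] by rewrite ysectionE.
  exact: measurable_ysection.
- by case: (Z1 y0) => // ZyT; exfalso; apply: Z0; move/seteqP : ZyT => [_]; apply.
- move=> x /= H; apply: contrapT => nZ; apply: H => _ /=.
  have -> : xsection Z x = [set y | Z (x, y)] by rewrite xsectionE.
  by case: (Z2 x) => // ZxT; exfalso; apply: nZ; move/seteqP : ZxT => [_]; apply.
Qed.

Lemma null_or_full_tuple d (T : measurableType d)
    (mu : {sigma_finite_measure set T -> \bar R}) n (Z : set (n.-tuple T)) :
  measurable Z ->
  (forall (v : 'I_n -> T) i,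
    null_or_full mu [set x | Z [tuple if j == i then x else v j | j < n]]) ->
  null_or_full (tuple_measure mu n) Z.
Proof.
elim: n Z => [|n IH] Z mZ Zl.
  have [Z0|Z0] := pselect (Z [tuple]); [right|left].
    by apply/seteqP; split=> // t _; rewrite tuple0.
  by rewrite /= diracE memNset.
pose cons_pair (p : T * n.-tuple T) := cons_tuple p.1 p.2.
have mcons : measurable_fun setT cons_pair.
  exact: (measurable_cons measurable_fst measurable_snd).
have mZ' : measurable (cons_pair @^-1` Z).
  by rewrite -[X in measurable X]setTI; exact: mcons.
have consE x (v : 'I_n.+1 -> T) :
    [tuple if j == ord0 then x else v j | j < n.+1] =
    cons_tuple x [tuple v (lift ord0 j) | j < n].
  apply: eq_from_tnth => j; rewrite tnth_mktuple.
  by case: (unliftP ord0 j) => [k ->|->]; rewrite ?tnth0 ?tnthS ?tnth_mktuple.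
have cons_lift x y (v : 'I_n -> T) i :
    cons_tuple x [tuple if j == i then y else v j | j < n] =
    [tuple if j == lift ord0 i then y else
           if unlift ord0 j is Some k then v k else x | j < n.+1].
  apply: eq_from_tnth => j; rewrite tnth_mktuple.
  case: (unliftP ord0 j) => [k ->|->]; last by rewrite tnth0.
  by rewrite tnthS tnth_mktuple (inj_eq lift_inj).
have [] : null_or_full (mu \x tuple_measure mu n)%E (cons_pair @^-1` Z).
- apply: null_or_full_prod => // [t|x].
    pose v j := if unlift ord0 j is Some k then tnth t k else point.
    have vE : t = [tuple v (lift ord0 j) | j < n].
      by apply: eq_from_tnth => j; rewrite tnth_mktuple /v liftK.
    have -> : [set x | Z (cons_pair (x, t))] =
        [set x | Z [tuple if j == ord0 then x else v j | j < n.+1]].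
      by apply/seteqP; split=> x; rewrite /= consE -vE.
    exact: Zl.
  apply: IH => [|v i].
    by rewrite -[X in measurable X]xsectionE; exact: measurable_xsection.
  have -> : [set y | Z (cons_pair (x, [tuple if j == i then y else v j | j < n]))] =
      [set y | Z [tuple if j == lift ord0 i then y else
         if unlift ord0 j is Some k then v k else x | j < n.+1]].
    by apply/seteqP; split=> y; rewrite /= -cons_lift.
  exact: Zl.
- by left.
- move=> ZT; right; apply/seteqP; split=> // t _.
  by rewrite (tuple_eta t); move/seteqP : ZT => [_ /(_ (thead t, behead_tuple t) I)].
Qed.

Definition line_at (T : Type) m n (M : 'M[T]_(m, n)) i j x : 'M[T]_(m, n) :=
  \matrix_(i', j') if (i', j') == (i, j) then x else M i' j'.

Lemma null_or_full_mx d (T : measurableType d)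
    (mu : {sigma_finite_measure set T -> \bar R}) m n (Z : set 'M[T]_(m, n)) :
  measurable Z ->
  (forall (M : 'M[T]_(m, n)) i j,
    null_or_full mu [set x | Z (line_at M i j x)]) ->
  null_or_full (mx_measure mu m n) Z.
Proof.
move=> mZ Zl; have mZ' : measurable (@tuple_mx T m n @^-1` Z).
  by rewrite -[X in measurable X]setTI; exact: measurable_tuple_mx.
have [] : null_or_full (tuple_measure mu (m * n)) (@tuple_mx T m n @^-1` Z).
- apply: null_or_full_tuple => // v k; case/mxvec_indexP: k => i j.
  have := Zl (\matrix_(i, j) v (mxvec_index i j)) i j.
  congr (null_or_full _ _); apply/seteqP.
  suff E x : line_at (\matrix_(i, j) v (mxvec_index i j)) i j x =
      tuple_mx [tuple if k == mxvec_index i j then x else v k | k < m * n].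
    by split=> x /=; rewrite E.
  apply/matrixP => i' j'; rewrite !mxE tnth_mktuple.
  by rewrite /mxvec_index (inj_eq (@cast_ord_inj _ _ _)) (inj_eq enum_rank_inj).
- by left.
- move=> ZT; right; apply/seteqP; split=> // M _.
  by rewrite -(mx_tupleK M); move/seteqP : ZT => [_]; apply.
Qed.

End NullOrFull.

Section FactorEntries.
Context {F : Type} {I J K r : nat}.

Definition entries (ABC : 'M[F]_(I, r) * 'M[F]_(J, r) * 'M[F]_(K, r))
    (p : factor_index I J K r) : F :=
  match p with
  | inl (inl il) => ABC.1.1 il.1 il.2
  | inl (inr jl) => ABC.1.2 jl.1 jl.2
  | inr kl => ABC.2 kl.1 kl.2
  end.

End FactorEntries.

Lemma poly_root_seq (F : fieldType) (p : {poly F}) : p != 0 ->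
  exists s : seq F, forall x, root p x = (x \in s).
Proof.
suff H n : forall q : {poly F}, size q = n -> q != 0 ->
    exists s : seq F, forall x, root q x = (x \in s).
  exact: H.
elim: n => [|n IH] q sq q0; first by move/eqP : sq; rewrite size_poly_eq0 (negPf q0).
have [[a qa]|nq] := pselect (exists a, root q a); last first.
  by exists nil => x; apply/negbTE/negP => qx; apply: nq; exists x.
have [q' qE] := factor_theorem q a qa.
have q'0 : q' != 0 by apply: contraNneq q0; rewrite qE => ->; rewrite mul0r.
have [|s sE] := IH q' _ q'0.
  by move: sq; rewrite qE size_Mmonic ?monicXsubC// size_XsubC addn2 /= => -[].
by exists (a :: s) => x; rewrite qE rootM root_XsubC sE inE orbC.
Qed.

(** The measurable structure is given by its class on the carrier of the field, so
    that the same type has both structures; the instances are the real and the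
    complex numbers. *)
Section PolynomialZeroSets.
Context {R : realType} {F : numFieldType} {d : measure_display}.
Variable mF : Measurable.axioms_ d F.
Let T : measurableType d := Measurable.Pack mF.
Variable mu : {sigma_finite_measure set T -> \bar R}.
Hypothesis measurable_add : forall d' (X : measurableType d') (f g : X -> T),
  measurable_fun setT f -> measurable_fun setT g ->
  measurable_fun setT ((fun x => (f x : F) + g x) : X -> T).
Hypothesis measurable_mul : forall d' (X : measurableType d') (f g : X -> T),
  measurable_fun setT f -> measurable_fun setT g ->
  measurable_fun setT ((fun x => (f x : F) * g x) : X -> T).
Hypothesis measurable_point : forall z : T, measurable [set z].
Hypothesis null_point : forall z : T, mu [set z] = 0%E.

Let null_seq (s : seq F) :
  measurable ([set x | x \in s] : set T) /\ mu ([set x | x \in s] : set T) = 0%E.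
Proof.
elim: s => [|a s [ms s0]].
  rewrite (_ : [set x | _] = set0 :> set T); first by split.
  by apply/seteqP; split.
have -> : [set x | x \in a :: s] = ([set a] `|` [set x | x \in s]) :> set T.
  apply/seteqP; split=> x /=; rewrite inE.
    by move=> /orP[/eqP|]; [left|right].
  by move=> [->|->]; rewrite ?eqxx ?orbT.
split; first exact: measurableU.
have : (mu ([set a] `|` [set x | x \in s]) <= mu [set a] + mu [set x | x \in s])%E.
  exact: measureU2.
by rewrite null_point s0 adde0 measure_le0 => /eqP.
Qed.

Let null_or_full_line (X : eqType) n (g : (X -> F) -> F) v x : multideg_le n g ->
  null_or_full mu ([set t | g (update v x t) = 0] : set T).
Proof.
move=> gn; have [p _ gp] := gn v x; have [p0|p0] := eqVneq p 0; [right|left].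
  by apply/seteqP; split=> // t _; rewrite /= gp p0 horner0.
have [s sE] := poly_root_seq p0.
have -> : [set t | g (update v x t) = 0] = [set x | x \in s].
  by apply/seteqP; split=> t /=; rewrite gp -sE => /rootP.
by have [] := null_seq s.
Qed.

Section Factors.
Variables (I J K r : nat).
Let Factors := ('M[T]_(I, r) * 'M[T]_(J, r) * 'M[T]_(K, r))%type.

Let measurable_entry m n i j : measurable_fun setT (fun M : 'M[T]_(m, n) => M i j).
Proof.
have -> : (fun M : 'M[T]_(m, n) => M i j) =
    (fun t => tnth t (mxvec_index i j)) \o @mx_tuple T m n.
  by apply/funext => M; rewrite /= tnth_mktuple mxvecE.
exact: measurableT_comp (measurable_tnth _) (@measurable_mx_tuple _ _ _ _).
Qed.

Let measurable_polyfun (g : (factor_index I J K r -> F) -> F) : polyfun g ->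
  measurable_fun setT ((fun ABC : Factors => g (entries ABC)) : Factors -> T).
Proof.
elim=> [c|p|g1 g2 _ m1 _ m2|g1 g2 _ m1 _ m2].
- exact: measurable_cst.
- case: p => [[[i l]|[j l]]|[k l]] /=.
  + apply: (measurableT_comp (measurable_entry i l)).
    exact: (measurableT_comp measurable_fst measurable_fst).
  + apply: (measurableT_comp (measurable_entry j l)).
    exact: (measurableT_comp measurable_snd measurable_fst).
  + exact: (measurableT_comp (measurable_entry k l) measurable_snd).
- exact: measurable_add.
- exact: measurable_mul.
Qed.

Lemma polyfun_zeros_null_or_full (g : (factor_index I J K r -> F) -> F) : polyfun g ->
  let Z : set Factors := [set ABC | g (entries ABC) = 0] in
  measurable Z /\ null_or_full (factor_measure mu I J K r) Z.
Proof.
move=> gP Z; have mZ : measurable Z.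
  by rewrite -[Z]setTI; exact: (measurable_polyfun gP _ (measurable_point 0)).
split=> //; have [n gn] := polyfun_multideg gP.
have mZC C : measurable [set AB | Z (AB, C)].
  by rewrite -[X in measurable X]ysectionE; exact: measurable_ysection.
apply: null_or_full_prod => // [C|AB].
  apply: null_or_full_prod => // [B|A].
  - apply: null_or_full_mx => [|M i j].
      rewrite -[X in measurable X](@ysectionE _ _ [set AB | Z (AB, C)]).
      exact: measurable_ysection.
    have entriesE t : entries (line_at M i j t, B, C) =
        update (entries (M, B, C)) (inl (inl (i, j))) t.
      apply/funext => -[[[i' l']|[j' l']]|[k' l']] //=.
      by rewrite mxE.
    have -> : [set t | Z (line_at M i j t, B, C)] =
        [set t | g (update (entries (M, B, C)) (inl (inl (i, j))) t) = 0] :> set T.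
      by apply/seteqP; split=> t; rewrite /Z /= entriesE.
    exact: null_or_full_line gn.
  - apply: null_or_full_mx => [|M i j].
      rewrite -[X in measurable X](@xsectionE _ _ [set AB | Z (AB, C)]).
      exact: measurable_xsection.
    have entriesE t : entries (A, line_at M i j t, C) =
        update (entries (A, M, C)) (inl (inr (i, j))) t.
      apply/funext => -[[[i' l']|[j' l']]|[k' l']] //=.
      by rewrite mxE.
    have -> : [set t | Z (A, line_at M i j t, C)] =
        [set t | g (update (entries (A, M, C)) (inl (inr (i, j))) t) = 0] :> set T.
      by apply/seteqP; split=> t; rewrite /Z /= entriesE.
    exact: null_or_full_line gn.
- apply: null_or_full_mx => [|M i j].
    by rewrite -[X in measurable X]xsectionE; exact: measurable_xsection.
  have entriesE t : entries (AB, line_at M i j t) =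
      update (entries (AB, M)) (inr (i, j)) t.
    apply/funext => -[[[i' l']|[j' l']]|[k' l']] //=.
    by rewrite mxE.
  have -> : [set t | Z (AB, line_at M i j t)] =
      [set t | g (update (entries (AB, M)) (inr (i, j)) t) = 0] :> set T.
    by apply/seteqP; split=> t; rewrite /Z /= entriesE.
  exact: null_or_full_line gn.
Qed.

Lemma negligible_generically (P : (factor_index I J K r -> F) -> Prop) : generically P ->
  (factor_measure mu I J K r).-negligible [set ABC : Factors | ~ P (entries ABC)].
Proof.
move=> [g [gP [v gv] gE]].
have [mZ [Z0|ZT]] := polyfun_zeros_null_or_full gP.
  exists [set ABC : Factors | g (entries ABC) = 0]; split => // ABC /= nP.
  by apply: contrapT => /eqP /gE.
exfalso; move/eqP : gv; apply.
pose ABC : Factors := (\matrix_(i, l) v (inl (inl (i, l))),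
  \matrix_(j, l) v (inl (inr (j, l))), \matrix_(k, l) v (inr (k, l))).
have -> : v = entries ABC.
  by apply/funext => -[[[i l]|[j l]]|[k l]]; rewrite /= mxE.
by move/seteqP : ZT => [_]; apply.
Qed.

Lemma negligible_nonunique_CPD : (1 < I)%N -> (1 < r)%N -> (J <= r)%N ->
  (r <= K)%N -> (r <= (I - 1) * (J - 1))%N ->
  (factor_measure mu I J K r).-negligible (nonunique_CPD F I J K r).
Proof.
move=> I2 r2 Jr rK rIJ.
have := negligible_generically (generically_CPD_unique I2 r2 Jr rK rIJ).
apply: negligibleS => -[[A B] C] /= nABC uABC; apply: nABC.
have mx_ofE m n (M : 'M[F]_(m, n)) : M = mx_of (fun il => M il.1 il.2).
  by apply/matrixP => i l; rewrite mxE.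
by rewrite (mx_ofE _ _ A) (mx_ofE _ _ B) (mx_ofE _ _ C).
Qed.

End Factors.
End PolynomialZeroSets.

(** * Complex numbers as a measurable field *)

Section ComplexMeasurable.
Variable R : realType.

Lemma measurable_complexP d' (X : measurableType d') (f : X -> R[i]) :
  measurable_fun setT f <->
  measurable_fun setT (fun x => complex.Re (f x)) /\
  measurable_fun setT (fun x => complex.Im (f x)).
Proof.
rewrite -(measurable_fun_pairP (fun x => complex_pair (f x))); split=> mf.
  exact: measurableT_comp (@measurable_complex_pair R) mf.
have -> : f = @pair_complex R \o (fun x => complex_pair (f x)).
  by apply/funext => x /=; case: (f x).
exact: measurableT_comp (@measurable_pair_complex R) mf.
Qed.

Lemma measurable_complexD d' (X : measurableType d') (f g : X -> R[i]) :
  measurable_fun setT f -> measurable_fun setT g ->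
  measurable_fun setT (fun x => f x + g x).
Proof.
move=> /measurable_complexP[fr fi] /measurable_complexP[gr gi].
apply/measurable_complexP; split.
  rewrite (_ : (fun x => _) = (fun x => complex.Re (f x)) \+ (fun x => complex.Re (g x))).
    exact: measurable_realfun.measurable_funD.
  by apply/funext => x /=; case: (f x); case: (g x).
rewrite (_ : (fun x => _) = (fun x => complex.Im (f x)) \+ (fun x => complex.Im (g x))).
  exact: measurable_realfun.measurable_funD.
by apply/funext => x /=; case: (f x); case: (g x).
Qed.

Lemma measurable_complexM d' (X : measurableType d') (f g : X -> R[i]) :
  measurable_fun setT f -> measurable_fun setT g ->
  measurable_fun setT (fun x => f x * g x).
Proof.
move=> /measurable_complexP[fr fi] /measurable_complexP[gr gi].
apply/measurable_complexP; split.
  rewrite (_ : (fun x => _) =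
    (fun x => complex.Re (f x)) \* (fun x => complex.Re (g x)) \-
    (fun x => complex.Im (f x)) \* (fun x => complex.Im (g x))).
    apply: measurable_realfun.measurable_funB;
      exact: measurable_realfun.measurable_funM.
  by apply/funext => x /=; case: (f x); case: (g x).
rewrite (_ : (fun x => _) =
  (fun x => complex.Re (f x)) \* (fun x => complex.Im (g x)) \+
  (fun x => complex.Im (f x)) \* (fun x => complex.Re (g x))).
  apply: measurable_realfun.measurable_funD;
    exact: measurable_realfun.measurable_funM.
by apply/funext => x /=; case: (f x); case: (g x).
Qed.

Lemma complex_set1E (z : R[i]) :
  @pair_complex R @^-1` [set z] = [set complex.Re z] `*` [set complex.Im z].
Proof.
case: z => a b; apply/seteqP; split=> -[x y] /=; first by case=> -> ->.
by case=> /= -> ->.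
Qed.

Lemma measurable_complex_set1 (z : R[i]) : measurable [set z].
Proof.
exists ([set complex.Re z] `*` [set complex.Im z]).
  by apply: measurableX; exact: measurable_set1.
rewrite setTI -complex_set1E -comp_preimage (_ : _ \o _ = id) ?preimage_id//.
by apply/funext => -[].
Qed.

Lemma complex_lebesgue_set1 (z : R[i]) : complex_lebesgue [set z] = 0%E.
Proof.
rewrite /complex_lebesgue /pushforward complex_set1E.
rewrite product_measure1E; [|exact: measurable_set1..].
by rewrite [X in (X * _)%E]lebesgue_measure_set1 mul0e.
Qed.

End ComplexMeasurable.

Theorem corollary1p7 (R : realType) (I J K r : nat) :
  (3 <= I)%N -> (I <= J)%N -> (J <= r)%N -> (r <= K)%N ->
  (r <= (I - 1) * (J - 1))%N ->
  generically_unique_CPD_real R I J K r /\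
  generically_unique_CPD_complex R I J K r.
Proof.
move=> I3 IJ Jr rK rIJ.
have I2 : (1 < I)%N by exact: ltnW.
have r2 : (1 < r)%N by exact: leq_trans (leq_trans I2 IJ) Jr.
split; refine (negligible_nonunique_CPD _ _ _ _ I2 r2 Jr rK rIJ).
- by move=> d X f g; exact: measurable_realfun.measurable_funD.
- by move=> d X f g; exact: measurable_realfun.measurable_funM.
- exact: measurable_set1.
- exact: lebesgue_measure_set1.
- exact: measurable_complexD.
- exact: measurable_complexM.
- exact: measurable_complex_set1.
- exact: complex_lebesgue_set1.
Qed.
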